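(* Let $X$ be a semi-Kelley continuum and let $Y\in C(X)$ be semi-terminal. Then $Y$ is semi-Kelley.
   Context: A continuum is a compact connected metric space with more than one point. A subcontinuum of a continuum $X$ is a non-empty compact connected subset of $X$ (one-point sets are allowed). $C(X)$ denotes the hyperspace of all subcontinua of $X$ with the Hausdorff metric; convergence of subcontinua is with respect to this metric. A subcontinuum $Y$ of $X$ is semi-terminal if for each $A,B\in C(X)$ with $A\cap B=\emptyset$ and $A\cap Y\neq\emptyset\neq B\cap Y$, we have $A\subset Y$ or $B\subset Y$. Let $K$ be a subcontinuum of $X$. A maximal limit continuum of $K$ is a subcontinuum $M\subset K$ for which there is a sequence $\{M_n\}_{n=1}^\infty$ of subcontinua of $X$ converging to $M$ such that for each convergent sequence $\{M_n'\}_{n=1}^\infty$ of subcontinua of $X$ with $M_n\subset M_n'$ for each $n\in\mathbb N$ and $\lim M_n'=M'\subset K$, we have $M'=M$. A continuum $X$ is semi-Kelley if for each subcontinuum $K$ of $X$ and every two maximal limit continua $L$ and $M$ of $K$, either $L\subset M$ or $M\subset L$. This definition is applied verbatim to one-point spaces, which satisfy it trivially. *)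

(* Defs.v *)
From mathcomp Require Import all_boot all_order all_algebra.
From mathcomp Require Import all_classical all_reals all_analysis.

Set Implicit Arguments.
Unset Strict Implicit.
Unset Printing Implicit Defensive.

Import Order.TTheory GRing.Theory Num.Theory.
Import numFieldNormedType.Exports.

Local Open Scope classical_set_scope.
Local Open Scope ring_scope.

(* A metric space is represented by a subset X of an ambient metric space T,
   with the distance of T; the case X = [set: T] is a metric type itself.
   Compactness and connectedness of a set, and the Hausdorff distance between
   two sets, do not depend on the ambient space, so that every notion below
   applies verbatim to X and to the subspaces of X. *)
Section Continua.
Context {R : realType} {T : metricType R}.
Implicit Types (X Y K L M A B : set T).

Definition continuum X : Prop :=
  [/\ compact X, connected X & exists x y, [/\ X x, X y & x <> y]].

(* [subcontinua X A] is the membership of A in C(X). *)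
Definition subcontinua X : set (set T) :=
  [set A | [/\ A `<=` X, A !=set0, compact A & connected A]].

Definition neighborhood (e : R) A : set T :=
  [set x | exists2 a, A a & mdist a x < e].

(* Extended-real valued because it may be infinite on arbitrary sets; it is
   finite, and a metric, on nonempty compact sets. *)
Definition hausdorff_dist A B : \bar R :=
  ereal_inf [set e%:E | e in [set e : R |
    [/\ 0 < e, A `<=` neighborhood e B & B `<=` neighborhood e A]]].

Definition hausdorff_cvg (M_ : nat -> set T) M : Prop :=
  hausdorff_dist (M_ n) M @[n --> \oo] --> 0%E.

Definition semi_terminal X Y : Prop :=
  forall A B, subcontinua X A -> subcontinua X B ->
    A `&` B = set0 -> A `&` Y !=set0 -> B `&` Y !=set0 ->
    A `<=` Y \/ B `<=` Y.

(* The approximating continua M_ n and M'_ n lie in X, not necessarily in K. *)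
Definition maximal_limit_continuum X K M : Prop :=
  [/\ subcontinua X M, M `<=` K &
    exists M_ : nat -> set T,
      [/\ forall n, subcontinua X (M_ n),
          hausdorff_cvg M_ M &
          forall (M'_ : nat -> set T) (M' : set T),
            (forall n, subcontinua X (M'_ n)) ->
            (forall n, M_ n `<=` M'_ n) ->
            subcontinua X M' -> hausdorff_cvg M'_ M' ->
            M' `<=` K -> M' = M]].

(* Nondegeneracy is not included, so that X may be a one-point space. *)
Definition semi_kelley X : Prop :=
  forall K, subcontinua X K ->
  forall L M, maximal_limit_continuum X K L -> maximal_limit_continuum X K M ->
    L `<=` M \/ M `<=` L.

End Continua.

(* Main.v *)
Require Import Defs.
From mathcomp Require Import all_boot all_order all_algebra.
From mathcomp Require Import all_classical all_reals all_analysis.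

(* Let M be a maximal limit continuum of K in Y, witnessed by M_n -> M; the same
   sequence witnesses maximality in X. Indeed let M_n <= M'_n -> M' <= K with
   M'_n in X. When M'_n is not in Y, boundary bumping applied to the component
   of M'_n & Y containing M_n gives either a continuum F_n between M_n and
   M'_n & Y that meets M', or a continuum E containing M_n, disjoint from M' and
   not in Y. If some n gives E, then M'_m misses E for large m, so that M'_m is
   in Y by semi-terminality. Otherwise M'_n can be replaced by F_n | M', which
   lies in Y and still converges to M'. In both cases M' = M by maximality in
   Y. *)

Local Open Scope classical_set_scope.
Local Open Scope ring_scope.

Import Order.TTheory GRing.Theory Num.Theory.

(** * Components and quasi-components of compact sets *)

Lemma closed_setD {T : topologicalType} (A U : set T) :
  closed A -> open U -> closed (A `\` U).
Proof.
by move=> cA oU; rewrite setDE; apply: closedI => //; exact: open_closedC.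
Qed.

(** If no member of [F] lies in [U], the sets [V]\[U] form a filter base in [K]; a cluster point
    lies in each of them, as they are closed, hence in the intersection but outside [U]. *)
Lemma compact_directed_bigcap {T : topologicalType} (K U : set T)
    (F : set (set T)) :
  compact K -> open U -> F !=set0 ->
  (forall V, F V -> closed V /\ V `<=` K) ->
  (forall V W, F V -> F W -> F (V `&` W)) ->
  \bigcap_(V in F) V `<=` U -> exists2 V, F V & V `<=` U.
Proof.
move=> cK oU [V0 FV0] clF FI capU; apply: contrapT => nU.
have VU0 V : F V -> V `\` U !=set0.
  move=> FV; apply: contrapT => VU; apply: nU; exists V => // y Vy.
  by apply: contrapT => nUy; apply: VU; exists y.
pose G := filter_from F (fun V => V `\` U).
have GF : Filter G.
  apply: filter_from_filter; first by exists V0.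
  by move=> V W FV FW; exists (V `&` W); [exact: FI|move=> y [[]]].
have GP : ProperFilter G by apply: filter_from_proper.
have GK : G K by exists V0 => // y [] /(proj2 (clF _ FV0)).
have [y [Ky Gy]] := cK G GP GK.
have clVU V : F V -> (V `\` U) y.
  move=> FV; suff : closed (V `\` U).
    by move/closure_id => -> => B By; apply: Gy => //; exists V.
  by apply: closed_setD => //; case: (clF _ FV).
have [_ nUy] := clVU _ FV0; apply: nUy; apply: capU => V FV.
by case: (clVU _ FV).
Qed.

(* Components of compact sets are quasi-components. *)
Lemma component_relatively_clopen {R : realType} {T : pseudoMetricType R}
    (W U : set T) (x : T) :
  compact W -> closed W -> W x -> open U ->
  connected_component W x `<=` U ->
  exists V, [/\ V x, V `<=` W `&` U, closed V & closed (W `\` V)].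
Proof.
move=> cW clW Wx oU CU.
pose F := [set V | [/\ V x, V `<=` W, closed V & closed (W `\` V)]].
have FI V V' : F V -> F V' -> F (V `&` V').
  move=> [Vx VW cV cWV] [V'x V'W cV' cWV']; split => //.
  - by move=> y [/VW].
  - exact: closedI.
  - by rewrite setDIr; exact: closedU.
have F0 : F !=set0 by exists W; split => //; rewrite setDv; exact: closed0.
have FK V : F V -> closed V /\ V `<=` W by case.
suff [V [Vx VW cV cWV] VU] : exists2 V, F V & V `<=` U.
  by exists V; split => // y Vy; split; [exact: VW|exact: VU].
apply: (@compact_directed_bigcap _ W _ F) => //.
(* [Q] is the quasi-component of [x] in [W]; once connected, it lies in the component of [x]. *)
set Q := \bigcap_(V in F) V; apply: subset_trans CU.
have Qx : Q x by move=> V [].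
have QW : Q `<=` W by case: F0 => V FV y /(_ _ FV); case: FV => _ + _ _; apply.
apply: connected_component_max => //.
apply/connectedP => E [E0 QE sE].
wlog Ex : E E0 QE sE / E false x.
  move=> wl; move: (Qx); rewrite QE => -[|Ex]; first exact: (wl E).
  by apply: (wl (E \o negb)) => //=; [rewrite setUC|
    rewrite separatedC].
have clQ : closed Q by apply: closed_bigI => V [].
have [sE1 sE2] := sE.
have clE b : closed (E b).
  apply/closure_id/seteqP; split; first exact: subset_closure.
  move=> y Ey; have : Q y.
    by rewrite (closure_id Q).1 //; apply: closureS Ey; rewrite QE; case: b => z;
       [right|left].
  rewrite QE; case: b Ey => Ey [] // Ey'; exfalso.
  - by have : (E false `&` closure (E true)) y by []; rewrite sE2.
  - by have : (closure (E false) `&` E true) y by []; rewrite sE1.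
have [G0 [G1 [oG0 oG1 EG0 EG1 G01]]] :
    exists G0 G1, [/\ open G0, open G1, E false `<=` G0, E true `<=` G1 &
                     G0 `&` G1 = set0].
  apply: ((normal_openP (R := R)).1 pseudometric_normal) => //.
  exact: separated_disjoint.
have [V [Vx VW cV cWV] VG] : exists2 V, F V & V `<=` G0 `|` G1.
  apply: (@compact_directed_bigcap _ W _ F) => //; first exact: openU.
  by rewrite -/Q QE => y []; [left; exact: EG0|right; exact: EG1].
(* This makes [V]&[G0] closed; it is also relatively open in [W], so it belongs to [F] and contains
   [Q], against [E true] being nonempty and inside [G1]. *)
have VG0 : V `&` G0 = V `\` G1.
  apply/seteqP; split=> y [Vy Gy]; split => //.
    by move=> G1y; have : (G0 `&` G1) y by []; rewrite G01.
  by case: (VG _ Vy).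
have FV' : F (V `&` G0).
  split; [by split => //; exact: EG0|by move=> y [/VW]| |].
    by rewrite VG0; exact: closed_setD.
  rewrite setDIr; apply: closedU => //.
  exact: closed_setD.
have [y Ey] := E0 true; have : (G0 `&` G1) y.
  split; last exact: EG1.
  by have : Q y; [rewrite QE; right|move=> /(_ _ FV') []].
by rewrite G01.
Qed.

(** * Boundary bumping *)

Section Continua.
Context {R : realType} {T : metricType R}.
Implicit Types (X Y Z P E F M : set T).

Lemma compact_closed_metric Z : compact Z -> closed Z.
Proof. by apply: compact_closed; exact: metric_hausdorff. Qed.

Lemma subcontinua_component Z x :
  compact Z -> Z x -> subcontinua Z (connected_component Z x).
Proof.
move=> cZ Zx; split; first exact: connected_component_sub.
- by exists x; exact: connected_component_refl.
- apply: (subclosed_compact _ cZ); last exact: connected_component_sub.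
  by apply: component_closed; exact: compact_closed_metric.
- exact: component_connected.
Qed.

Lemma subcontinuaS X Z E : X `<=` Z -> subcontinua X E -> subcontinua Z E.
Proof. by move=> XZ [EX *]; split => //; exact: subset_trans XZ. Qed.

(** The cases are whether or not the component [D] of [Z]&[Y] containing [M] meets [P]. If it does
    not, [E] is a component of [Z] minus a neighborhood of [P]. Were [E] inside [Y], it would lie in
    [D], away from that neighborhood, and a clopen piece around it would disconnect [Z]. *)
Lemma boundary_bumping Z Y P M :
  compact Z -> connected Z -> closed Y -> closed P ->
  M !=set0 -> connected M -> M `<=` Z `&` Y -> ~ Z `<=` Y ->
  (exists F, [/\ subcontinua (Z `&` Y) F, M `<=` F & F `&` P !=set0]) \/
  (exists E, [/\ subcontinua Z E, M `<=` E, E `&` P = set0 & ~ E `<=` Y]).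
Proof.
move=> cZ coZ clY clP [x Mx] coM MZY nZY.
have clZ := compact_closed_metric _ cZ.
have cZY : compact (Z `&` Y) by exact: compact_closedI.
have [Zx Yx] := MZY _ Mx.
set D := connected_component (Z `&` Y) x.
have sD : subcontinua (Z `&` Y) D by exact: subcontinua_component.
have [DP|/set0P/negP/negPn/eqP DP] := pselect (D `&` P !=set0).
  by left; exists D; split => //; exact: connected_component_max.
right.
have [DZY D0 cD coD] := sD.
have [U [U' [oU oU' DU PU' UU']]] :
    exists U V, [/\ open U, open V, D `<=` U, P `<=` V & U `&` V = set0].
  apply: ((normal_openP (R := R)).1 pseudometric_normal) => //.
  exact: compact_closed_metric.
pose W := Z `\` U'.
have clW : closed W by exact: closed_setD.
have cW : compact W by apply: (subclosed_compact clW cZ) => y [].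
have UW : Z `&` U `<=` W.
  move=> y [Zy Uy]; split => // U'y.
  by have : (U `&` U') y by []; rewrite UU'.
have Dx : D x by exact: connected_component_refl.
have Wx : W x by apply: UW; split => //; exact: DU.
have sE := subcontinua_component _ _ cW Wx.
exists (connected_component W x); split.
- by apply: subcontinuaS sE => y [].
- apply: connected_component_max => //.
  apply: (@subset_trans _ D); first exact: connected_component_max.
  by move=> y Dy; apply: UW; split; [case: (DZY _ Dy)|exact: DU].
- apply/seteqP; split => // y [+ Py].
  by move=> /connected_component_sub [_]; apply; exact: PU'.
move=> EY.
have [V [Vx VWU cV cWV]] : exists V,
    [/\ V x, V `<=` W `&` U, closed V & closed (W `\` V)].
  apply: (component_relatively_clopen _ _ x cW) => //; apply: subset_trans DU.
  apply: connected_component_max; first exact: connected_component_refl.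
    by move=> y Ey; split; [case: (connected_component_sub Ey)|exact: EY].
  exact: component_connected.
have VZ : V `<=` Z by move=> y /VWU [[]].
(* [V] is open in [Z] as well as in [W], because it lies in [U] and [Z]&[U] is inside [W]. *)
have ZV : V = Z.
  apply: coZ; first by exists x.
  - exists (U `\` (W `\` V)).
      by rewrite setDE; apply: openI => //; exact: closed_openC.
    apply/seteqP; split => [y Vy|y [Zy [Uy nWV]]].
      by split; [exact: VZ|split; [case: (VWU _ Vy)|case]].
    by apply: contrapT => nVy; apply: nWV; split => //; exact: UW.
  - by exists V => //; rewrite setIC; apply/esym/setIidPl.
have ZW : Z `<=` W by rewrite -{1}ZV => y /VWU [].
apply: nZY => y Zy; apply: EY; exact: (connected_component_max Zx ZW coZ).
Qed.

(** * Hausdorff convergence *)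

Lemma neighborhood_disjoint E P : compact E -> closed P -> E `&` P = set0 ->
  exists2 e : R, 0 < e & E `&` neighborhood e P = set0.
Proof.
move=> /compact_near_coveringP cE clP EP.
(* Compactness in near-covering form turns the radii found around the points of [E] into one [e]. *)
have : \forall e \near 0^'+, E `<=` [set y | ~ neighborhood e P y].
  apply: cE => y Ey; have /nbhs_ballP[r r0 rP] : nbhs y (~` P).
    apply: open_nbhs_nbhs; split; first exact: closed_openC.
    by move=> Py; have : (E `&` P) y by []; rewrite EP.
  have r20 : 0 < r / 2 by exact: divr_gt0.
  exists (ball y (r / 2), [set e | e < r / 2]).
    by split; [exact: nbhsx_ballx|exact: nbhs_right_lt].
  move=> [z e] [/= yz er] [a Pa]; rewrite metric_sym => za.
  apply: (rP a) => //; apply: (ball_split yz).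
  by rewrite ballEmdist /=; exact: lt_trans er.
have PF : ProperFilter (0^'+ : set_system R) by exact: at_right_proper_filter.
move=> EnP.
have [e [nP e0]] := @filter_ex _ _ PF _ (filterI EnP (@nbhs_right_gt R 0)).
by exists e => //; apply/seteqP; split => // y [/nP].
Qed.

Lemma hausdorff_cvg_neighborhood (M_ : nat -> set T) M (e : R) :
  hausdorff_cvg M_ M -> 0 < e -> \forall n \near \oo, M_ n `<=` neighborhood e M.
Proof.
move=> cM e0; have : \forall n \near \oo, (hausdorff_dist (M_ n) M < e%:E)%E.
  by apply: (cM [set u | (u < e%:E)%E]); apply: open_ereal_lt'; rewrite lte_fin.
apply: filterS => n /ereal_inf_lt[_ [d [d0 Md _] <-]]; rewrite lte_fin => de y.
by move=> /Md[a Ma /lt_trans-/(_ _ de)]; exists a.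
Qed.

Lemma hausdorff_dist_ge0 E M : (0 <= hausdorff_dist E M)%E.
Proof.
by apply: le_ereal_inf_tmp => _ [e [e0 _ _] <-]; rewrite lee_fin ltW.
Qed.

(** Adding [M] makes one of the two inclusions trivial, so only the upper bound on [F] matters. *)
Lemma hausdorff_dist_setU E F M : F `<=` E ->
  (hausdorff_dist (F `|` M) M <= hausdorff_dist E M)%E.
Proof.
move=> FE; apply: ereal_inf_le_tmp => _ [e [e0 EM ME] <-]; exists e => //.
have MM A : A `<=` neighborhood e A by move=> y Ay; exists y => //; rewrite mdistxx.
by split => // y; [case=> [/FE/EM //|/MM]|move=> My; apply: MM; right].
Qed.

Lemma hausdorff_cvg_le (E_ F_ : nat -> set T) M :
  (\forall n \near \oo, (hausdorff_dist (F_ n) M <= hausdorff_dist (E_ n) M)%E) ->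
  hausdorff_cvg E_ M -> hausdorff_cvg F_ M.
Proof.
move=> FE; apply: squeeze_cvge (cvg_cst 0%E).
by apply: filterS FE => n ->; rewrite hausdorff_dist_ge0.
Qed.

(** * Passing from [Y] to [X] *)

Lemma maximal_limit_continuum_semi_terminal X Y K M :
  subcontinua X Y -> semi_terminal X Y -> K `<=` Y ->
  maximal_limit_continuum Y K M -> maximal_limit_continuum X K M.
Proof.
move=> [YX Y0 cY coY] stY KY [sM MK [M_ [sM_ cvM maxM]]].
split => //; first exact: subcontinuaS sM.
exists M_; split => //; first by move=> n; exact: subcontinuaS (sM_ n).
move=> M'_ M' sM'_ MM'_ sM' cvM' M'K.
have [M'X M'0 cM' coM'] := sM'.
have sYM' : subcontinua Y M' by split => //; exact: subset_trans KY.
have [[k [E [sE ME EM' nEY]]]|nE] := pselect (exists k E,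
    [/\ subcontinua X E, M_ k `<=` E, E `&` M' = set0 & ~ E `<=` Y]).
  have [e e0 EeM'] : exists2 e : R, 0 < e & E `&` neighborhood e M' = set0.
    by apply: neighborhood_disjoint => //; [case: sE|exact: compact_closed_metric].
  have M'Y : \forall n \near \oo, M'_ n `<=` Y.
    have := hausdorff_cvg_neighborhood _ _ _ cvM' e0; apply: filterS => n M'e.
    have meetY A j : M_ j `<=` A -> A `&` Y !=set0.
      by case: (sM_ j) => MY [y My] _ _ MA; exists y; split; [exact: MA|exact: MY].
    have M'E : M'_ n `&` E = set0.
      apply/seteqP; split => // y [/M'e ey Ey].
      by have : (E `&` neighborhood e M') y by []; rewrite EeM'.
    by case: (stY _ _ (sM'_ n) sE M'E (meetY _ _ (MM'_ n)) (meetY _ _ ME)).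
  (* Only finitely many [M'_ n] can leave [Y]; replacing them by [M_ n] does not change the
     limit. *)
  pose N_ n := if `[< M'_ n `<=` Y >] then M'_ n else M_ n.
  apply: (maxM N_) => //.
  - move=> n; rewrite /N_; case: asboolP => [M'nY|_]; last exact: sM_.
    by case: (sM'_ n) => *; split.
  - by move=> n; rewrite /N_; case: asboolP => // _ y.
  - apply: hausdorff_cvg_le cvM'; apply: filterS M'Y => n M'nY.
    by rewrite /N_ asboolT.
have [N_ NP] : {N_ : nat -> set T & forall n, [/\ subcontinua Y (N_ n),
    M_ n `<=` N_ n &
    (hausdorff_dist (N_ n) M' <= hausdorff_dist (M'_ n) M')%E]}.
  apply: (@choice _ _ (fun n N => [/\ subcontinua Y N, M_ n `<=` N &
    (hausdorff_dist N M' <= hausdorff_dist (M'_ n) M')%E])) => n.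
  have [M'X_ M'0_ cM'_ coM'_] := sM'_ n.
  have [M'nY|M'nY] := pselect (M'_ n `<=` Y).
    by exists (M'_ n); split.
  have [MY_ M0_ cM_ coM_] := sM_ n.
  have MMY : M_ n `<=` M'_ n `&` Y.
    by move=> y My; split; [exact: MM'_|exact: MY_].
  have [[F [sF MF FM']]|[E [sE ME EM' nEY]]] :=
    boundary_bumping _ Y M' (M_ n) cM'_ coM'_ (compact_closed_metric _ cY)
      (compact_closed_metric _ cM') M0_ coM_ MMY M'nY.
  (* The union is connected because [F] meets [M'], and lies in [Y] because [M'] is inside [K]. *)
  - have [FZ F0 cF coF] := sF; exists (F `|` M'); split.
    + split; [|by case: F0 => y; exists y; left|exact: compactU|exact: connectedU].
      by move=> y [/FZ[]//|/M'K/KY].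
    + by move=> y /MF; left.
    + by apply: hausdorff_dist_setU => y /FZ[].
  - exfalso; apply: nE; exists n, E; split => //.
    exact: subcontinuaS sE.
apply: (maxM N_) => //.
- by move=> n; case: (NP n).
- by move=> n; case: (NP n).
- by apply: hausdorff_cvg_le cvM'; near=> n; case: (NP n).
Unshelve. all: by end_near. Qed.

End Continua.

Theorem theorem3p3 (R : realType) (T : metricType R) (X Y : set T) :
  continuum X -> semi_kelley X -> subcontinua X Y -> semi_terminal X Y ->
  semi_kelley Y.
Proof.
move=> _ skX sY stY K sK L M mL mM.
have KY : K `<=` Y by case: sK.
by apply: (skX K); [case: sY => YX *; exact: subcontinuaS sK| |];
  exact: maximal_limit_continuum_semi_terminal stY KY _.
Qed.
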